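(* Let $k\in\mathbb{R}$, let $\tilde p(z)=\frac{1+z}{1-z}\operatorname{Re}\tilde p(0)+i\operatorname{Im}\tilde p(0)$ with $\operatorname{Re}\tilde p(0)\ge0$, and let $\phi_t(z,\omega)$ be the stochastic evolution defined in the context. For $z\in\mathbb{D}$ put $r(t)=|\phi_t(z,\omega)|$ and $r_0=|z|$. Then for all $t\ge0$ $$\tanh\left(-|\tilde p(0)|\,t+\operatorname{arctanh}r_0\right)\le r(t)\le\tanh\left(|\tilde p(0)|\,t+\operatorname{arctanh}r_0\right).$$
   Context: $\mathbb{D}$ is the open unit disk. Let $B_t(\omega)$ be a standard 1-dimensional Brownian motion ($B_0=0$, continuous paths) on a probability space $\Omega$, and let $\tau(t,\omega)=e^{ikB_t(\omega)}$. For each fixed $\omega\in\Omega$, $\phi_t(z,\omega)$ is the unique solution, for $z\in\mathbb{D}$ and $t\ge0$, of $$\frac{d}{dt}\phi_t(z,\omega)=\frac{(\tau(t,\omega)-\phi_t(z,\omega))^2}{\tau(t,\omega)}\,\tilde p\!\left(\frac{\phi_t(z,\omega)}{\tau(t,\omega)}\right),\qquad \phi_0(z,\omega)=z;$$ for each $\omega$ and $t$, $z\mapsto\phi_t(z,\omega)$ is a holomorphic self-map of $\mathbb{D}$. *)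

(* Defs.v *)
From mathcomp Require Export all_boot all_order all_algebra.
From mathcomp Require Export complex.
From mathcomp Require Export all_classical all_reals all_analysis.
From mathcomp Require Export measurable_realfun.
Export Order.TTheory GRing.Theory Num.Theory.
Export numFieldNormedType.Exports.
Export Normc.

Set Implicit Arguments.
Unset Strict Implicit.
Unset Printing Implicit Defensive.

Local Open Scope classical_set_scope.
Local Open Scope complex_scope.
Local Open Scope ring_scope.

Definition tanh (R : realType) (x : R) : R :=
  (expR x - expR (- x)) / (expR x + expR (- x)).

(* The usual closed form; meaningful for -1 < x < 1. *)
Definition artanh (R : realType) (x : R) : R := ln ((1 + x) / (1 - x)) / 2.

Definition cexp (R : realType) (z : R[i]) : R[i] :=
  (expR (complex.Re z))%:C * (cos (complex.Im z) +i* sin (complex.Im z)).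

(* f has derivative l at t, as a function on [0, +oo[ : a two-sided derivative
   for 0 < t and a right derivative for t = 0.  The topology of C as a normed
   space is carried by R[i]^o. *)
Definition has_derivative_ge0 (R : realType) (f : R -> R[i]) (t : R)
    (l : R[i]) : Prop :=
  (fun s : R => ((s - t)^-1)%:C * (f s - f t) : R[i]^o)
    @ within [set s : R | 0 <= s] t^' --> (l : R[i]^o).

(* The product rule over the whole family gives it for every subfamily, by
   taking A i = setT. *)
Definition mutually_independent (R : realType) (d : measure_display)
    (Omega : measurableType d) (P : probability Omega R) (n : nat)
    (X : 'I_n -> {RV P >-> R}) : Prop :=
  forall A : 'I_n -> set R, (forall i, measurable (A i)) ->
    P (\bigcap_i (X i @^-1` A i)) = (\prod_(i < n) P (X i @^-1` A i))%E.

Definition increment (R : realType) (d : measure_display)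
    (Omega : measurableType d) (P : probability Omega R)
    (B : R -> {RV P >-> R}) (s t : R) : {RV P >-> R} :=
  (B t : {mfun Omega >-> R}) - (B s : {mfun Omega >-> R}).

(* Only the values B t with 0 <= t matter. *)
Record brownian_motion (R : realType) (d : measure_display)
    (Omega : measurableType d) (P : probability Omega R)
    (B : R -> {RV P >-> R}) : Prop := BrownianMotion {
  bm_start : forall omega, B 0 omega = 0;
  bm_continuous : forall omega,
    {within [set t : R | 0 <= t], continuous (fun t : R => B t omega)};
  bm_independent_increments : forall (n : nat) (t : nat -> R),
    0 <= t 0%N -> {homo t : i j / (i <= j)%N >-> i <= j} ->
    mutually_independent (fun i : 'I_n => increment B (t i) (t i.+1));
  (* the second argument of normal_prob is the standard deviation *)
  bm_gaussian_increments : forall s t : R, 0 <= s -> s < t ->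
    forall A : set R, measurable A ->
    distribution P (increment B s t) A = normal_prob 0 (Num.sqrt (t - s)) A
}.

Definition driving_term (R : realType) (Omega : Type) (k : R)
    (B : R -> Omega -> R) (t : R) (omega : Omega) : R[i] :=
  cexp ('i%C * (k * B t omega)%:C).

(* For every omega and every z in the unit disk, phi _ z omega solves the
   equation driven by tau.  Being a solution includes staying in the unit disk,
   the domain of p: when |tau| = 1, phi / tau then stays there too. *)
Record stochastic_evolution (R : realType) (Omega : Type)
    (tau : R -> Omega -> R[i]) (p : R[i] -> R[i])
    (phi : R -> R[i] -> Omega -> R[i]) : Prop := StochasticEvolution {
  evolution_disk : forall omega (t : R) (z : R[i]), 0 <= t -> normc z < 1 ->
    normc (phi t z omega) < 1;
  evolution_start : forall omega (z : R[i]), normc z < 1 -> phi 0 z omega = z;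
  evolution_ode : forall omega (t : R) (z : R[i]), 0 <= t -> normc z < 1 ->
    has_derivative_ge0 (fun s => phi s z omega) t
      ((tau t omega - phi t z omega) ^+ 2 / tau t omega
         * p (phi t z omega / tau t omega))
}.

(* Main.v *)
(* Put r = |phi|.  Rotating by the unimodular tau, the equation gives
   (r^2)' = 2 (1 - r^2) Re (conj(p 0) q) with q = phi / tau, hence
   |(r^2)'| <= 2 |p 0| r (1 - r^2): where r > 0, the hyperbolic distance
   artanh r is |p 0|-Lipschitz in time.  Only the modulus of tau matters, so the
   bound is pathwise.  Where r vanishes it need not be differentiable, so
   artanh r is replaced by a smooth function of r^2 depending on e > 0, whose
   derivative along the flow is bounded by (1 + e)^(1/2) |p 0|, and e tends
   to 0. *)

Require Import Defs.
From mathcomp Require Import ring lra.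

Local Open Scope classical_set_scope.
Local Open Scope complex_scope.
Local Open Scope ring_scope.

Set Implicit Arguments.
Unset Strict Implicit.
Unset Printing Implicit Defensive.

(** * Differentiability on the closed half-line, component by component *)

Section RealDerivative.
Context {R : realType}.
Implicit Types (g : R -> R) (t l : R).

Definition real_derivative_ge0 g t l : Prop :=
  (s - t)^-1 * (g s - g t) @[s --> within [set s | 0 <= s] t^'] --> l.

(** The bound by [normc] makes [g] 1-Lipschitz, and real homogeneity lets it pass the factor
    [(s - t)^-1], so the difference quotients of [g \o f] converge along with those of [f]. Meant
    for the real and imaginary parts. *)
Lemma has_derivative_ge0_additive (g : {additive R[i] -> R})
    (gM : forall (c : R) w, g (c%:C * w) = c * g w)
    (g_le : forall w, `|g w| <= normc w) (f : R -> R[i]) t (l : R[i]) :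
  has_derivative_ge0 f t l -> real_derivative_ge0 (g \o f) t (g l).
Proof.
move=> fl; apply/(@cvgrPdist_lt _ R^o) => e e0.
have eC : 0 < e%:C by rewrite ltcR.
move/(@cvgrPdist_lt _ R[i]^o) : fl => /(_ _ eC); apply: filterS => s.
rewrite normc_def ltcR /= -(raddfB g) -gM -(raddfB g).
apply: le_lt_trans; apply: (le_trans (g_le _)).
by case: (X in normc X).
Qed.

Lemma has_derivative_ge0_Re (f : R -> R[i]) t (l : R[i]) :
  has_derivative_ge0 f t l ->
  real_derivative_ge0 (fun s => complex.Re (f s)) t (complex.Re l).
Proof.
apply: has_derivative_ge0_additive => [c [x y]|[x y]] /=.
  by rewrite mul0r subr0.
by rewrite -sqrtr_sqr ler_wsqrtr// lerDl sqr_ge0.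
Qed.

Lemma has_derivative_ge0_Im (f : R -> R[i]) t (l : R[i]) :
  has_derivative_ge0 f t l ->
  real_derivative_ge0 (fun s => complex.Im (f s)) t (complex.Im l).
Proof.
apply: has_derivative_ge0_additive => [c [x y]|[x y]] /=.
  by rewrite mul0r addr0.
by rewrite -sqrtr_sqr ler_wsqrtr// lerDr sqr_ge0.
Qed.

Lemma real_derivative_ge0_is_derive g t l :
  0 < t -> real_derivative_ge0 g t l -> is_derive t 1 g l.
Proof.
move=> t0 gl.
have gl' : h^-1 *: ((g \o shift t) (h *: 1) - g t) @[h --> 0^'] --> (l : R^o).
  apply/(@cvgrPdist_lt _ R^o) => e e0.
  have : \forall s \near t, s != t -> 0 <= s ->
      `|l - (s - t)^-1 * (g s - g t)| < e.
    by move/(@cvgrPdist_lt _ R^o) : gl => /(_ _ e0).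
  (* Since [0 < t], all points near [t] are positive, so the constraint [0 <= s] disappears. *)
  move=> /(filterI (lt_nbhsr t0)) gs.
  have {gs} : \forall s \near t, s != t -> `|l - (s - t)^-1 * (g s - g t)| < e.
    by apply: filterS gs => s [/ltW s0 H] st; exact: H.
  rewrite (near_shift 0 t) subr0; apply: filterS => h /= + h0.
  rewrite addrK [h%:A]mulr1; apply.
  by rewrite -subr_eq0 addrK.
split; first by apply/cvg_ex; exists l.
exact: cvg_lim gl'.
Qed.

Lemma real_derivative_ge0_cvg g t l : real_derivative_ge0 g t l ->
  g s @[s --> within [set s | 0 <= s] t^'] --> g t.
Proof.
move=> gl; set F := within _ _.
have tF : s @[s --> F] --> t by do 2 apply: cvg_within_filter; exact: cvg_id.
(* Away from [t] this expression equals [g s]. *)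
have : g t + (s - t) * ((s - t)^-1 * (g s - g t)) @[s --> F]
    --> g t + (t - t) * l.
  apply: cvgD; first exact: cvg_cst.
  by apply: cvgM => //; apply: cvgB => //; exact: cvg_cst.
rewrite subrr mul0r addr0.
apply: cvg_trans; apply: near_eq_cvg.
have : \forall s \near F, s != t 
  by exact: (filterS (fun s st _ => st) (nbhs_dnbhs_neq t)).
apply: filterS => s st /=.
by rewrite mulVKf ?subr_eq0// subrKC.
Qed.

(** Supplies continuity at the endpoint 0 for the mean value theorem on [[0, t]]; only a one-sided
    derivative exists there. *)
Lemma real_derivative_ge0_cvg_right g l : real_derivative_ge0 g 0 l ->
  g s @[s --> 0^'+] --> g 0.
Proof.
move=> /real_derivative_ge0_cvg; apply: cvg_trans; apply: cvg_app.
move=> A A0.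
have {A0} : \forall s \near (0 : R), s != 0 -> 0 <= s -> A s by exact: A0.
suff : (\forall s \near (0 : R), s != 0 -> 0 <= s -> A s) ->
  \forall s \near (0 : R), 0 < s -> A s by [].
apply: filterS => s sA s0.
by apply: sA; [rewrite gt_eqF|exact: ltW].
Qed.

End RealDerivative.

Section Evolution.
Context {R : realType}.
Implicit Types (c e s t x y : R) (p q u w : R[i]).

(** * Radial velocity of the flow *)

Lemma normc_sqrE w : normc w ^+ 2 = complex.Re w ^+ 2 + complex.Im w ^+ 2.
Proof. by case: w => x y /=; rewrite sqr_sqrtr// addr_ge0// sqr_ge0. Qed.

Lemma normc_ge0 w : 0 <= normc w.
Proof. by case: w => x y; exact: sqrtr_ge0. Qed.

(** Cauchy-Schwarz through Lagrange's identity: the squares of the two sides differ by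
    [(a * y - b * x) ^+ 2]. *)
Lemma ler_norm_dot_normc p q :
  `|complex.Re p * complex.Re q + complex.Im p * complex.Im q|
    <= normc p * normc q.
Proof.
case: p q => a b [x y] /=; rewrite -sqrtrM ?addr_ge0 ?sqr_ge0//.
rewrite -sqrtr_sqr ler_wsqrtr// -subr_ge0.
rewrite [leRHS](_ : _ = (a * y - b * x) ^+ 2) ?sqr_ge0//; ring.
Qed.

Lemma normc_driving_term (Omega : Type) (k : R) (B : R -> Omega -> R) t omega :
  normc (driving_term k B t omega) = 1.
Proof.
rewrite /driving_term /cexp /= !(mul0r, mul1r, mulr0, oppr0, addr0, add0r).
by rewrite expR0 !mul1r cos2Dsin2 sqrtr1.
Qed.

(* With [q = w / u], rotation invariance gives
   [Re (w^* V) = Re (q^* (a (1 - q ^+ 2) + i b (1 - q) ^+ 2))]. *)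
Lemma dot_velocity p0 u w (V := (u - w) ^+ 2 / u *
    ((1 + w / u) / (1 - w / u) * (complex.Re p0)%:C
     + 'i%C * (complex.Im p0)%:C)) :
  normc u = 1 -> normc w < 1 ->
  complex.Re w * complex.Re V + complex.Im w * complex.Im V =
  (1 - normc w ^+ 2) *
    (complex.Re p0 * complex.Re (w / u) + complex.Im p0 * complex.Im (w / u)).
Proof.
move=> u1 w1.
have u0 : u != 0.
  by apply: contra_eq_neq u1 => ->; rewrite normc0 eq_sym oner_eq0.
set q := w / u in V *; have wE : w = u * q by rewrite mulrC divfK.
have q1 : 1 - q != 0.
  rewrite subr_eq0; apply/eqP => q1; move: w1.
  by rewrite wE -q1 mulr1 u1 ltxx.
(* One factor of [(1 - q) ^+ 2] cancels the denominator [1 - q]. *)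
have -> : V = u * ((1 - q ^+ 2) * (complex.Re p0)%:C
    + (1 - q) ^+ 2 * ('i%C * (complex.Im p0)%:C)).
  by rewrite /V {}wE; field; rewrite u0 q1.
rewrite {V} normc_sqrE wE; have := normc_sqrE u; rewrite u1 expr1n.
case: u q {u1 u0 q1 wE w1} => c s [x y]; case: p0 => a b /= cs.
(* The left side carries [c ^+ 2 + s ^+ 2], the squared modulus of [u], as an outer factor, the
   right side inside [1 - normc w ^+ 2]. As it equals 1, it can be moved. *)
transitivity ((c ^+ 2 + s ^+ 2) * (1 - (x ^+ 2 + y ^+ 2)) * (a * x + b * y)).
  by ring.
transitivity ((1 - (c ^+ 2 + s ^+ 2) * (x ^+ 2 + y ^+ 2)) * (a * x + b * y)).
  by rewrite -cs !mul1r.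
by ring.
Qed.

(** * Regularised hyperbolic distance *)

(* Twice [artanh (sqrt ((s + e) / (1 + e)))]: for [0 < e] it is differentiable
   at [s = 0], where [artanh \o Num.sqrt] is not. *)
Definition reg_artanh e s : R :=
  ln (Num.sqrt (1 + e) + Num.sqrt (s + e))
  - ln (Num.sqrt (1 + e) - Num.sqrt (s + e)).

(** The two logarithms contribute [K / (r * (K ^+ 2 - r ^+ 2))]. Shifting both 1 and [s] by [e]
    makes [e] cancel in [K ^+ 2 - r ^+ 2 = 1 - s]. *)
Lemma is_derive_reg_artanh e s : 0 < e -> 0 <= s -> s < 1 ->
  is_derive s 1 (reg_artanh e)
    (Num.sqrt (1 + e) / (Num.sqrt (s + e) * (1 - s))).
Proof.
move=> e0 s0 s1; set K := Num.sqrt (1 + e); set r := Num.sqrt (s + e).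
have se0 : 0 < s + e by rewrite ltr_wpDl.
have r0 : 0 < r by rewrite sqrtr_gt0.
have rK : r < K by rewrite ltr_sqrt ?ltrD2r// ltr_wpDl.
have K2 : K ^+ 2 = 1 + e by rewrite sqr_sqrtr// addr_ge0// ltW.
have r2 : r ^+ 2 = s + e by rewrite sqr_sqrtr// ltW.
have dr : is_derive s 1 (fun s => Num.sqrt (s + e)) (2 * r)^-1.
  apply: (is_derive_eq (f' := (2 * r)^-1 * (1 + 0))); 
    last by rewrite addr0 mulr1.
  apply: (@is_derive1_comp _ Num.sqrt (id + cst e) s (2 * r)^-1 (1 + 0)).
  exact: is_derive1_sqrt.
have dp : is_derive s 1 (fun s => ln (K + Num.sqrt (s + e)))
    ((K + r)^-1 * (0 + (2 * r)^-1)).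
  apply: (@is_derive1_comp _ (@ln R) (cst K + (fun s => Num.sqrt (s + e)))).
  by apply: is_derive1_ln; rewrite addr_gt0// (lt_trans r0).
have dm : is_derive s 1 (fun s => ln (K - Num.sqrt (s + e)))
    ((K - r)^-1 * (0 - (2 * r)^-1)).
  apply: (@is_derive1_comp _ (@ln R) (cst K - (fun s => Num.sqrt (s + e)))).
  by apply: is_derive1_ln; rewrite subr_gt0.
apply: (is_derive_eq
  (f' := (K + r)^-1 * (0 + (2 * r)^-1) - (K - r)^-1 * (0 - (2 * r)^-1))).
have -> : 1 - s = K ^+ 2 - r ^+ 2 by rewrite K2 r2; ring.
rewrite subr_sqr; field.
by rewrite !lt0r_neq0 ?subr_gt0// addr_gt0// (lt_trans r0).
Qed.

Lemma cvg_reg_artanh s : 0 <= s -> s < 1 ->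
  reg_artanh e s @[e --> 0^'+] --> 2 * artanh (Num.sqrt s).
Proof.
move=> s0 s1; have r1 : Num.sqrt s < 1 by rewrite -sqrtr1 ltr_sqrt.
have r0 := sqrtr_ge0 s.
have -> : 2 * artanh (Num.sqrt s) = reg_artanh 0 s.
  rewrite /artanh /reg_artanh mulrC divfK ?pnatr_eq0// !addr0 sqrtr1.
  by rewrite ln_div// posrE ?subr_gt0// ltr_wpDr.
apply: cvg_at_right_filter.
have sq (a : R) : Num.sqrt (a + e) @[e --> (0 : R)] --> Num.sqrt (a + 0).
  apply: (@continuous_comp _ _ _ (fun e : R => a + e) Num.sqrt);
    last exact: sqrt_continuous.
  by apply: cvgD; [exact: cvg_cst|exact: cvg_id].
apply: cvgB.
- apply: (continuous_cvg _ (continuous_ln _)) (cvgD (sq 1) (sq s)).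
  by rewrite !addr0 sqrtr1 ltr_wpDr.
- apply: (continuous_cvg _ (continuous_ln _)) (cvgB (sq 1) (sq s)).
  by rewrite !addr0 sqrtr1 subr_gt0.
Qed.

(** Used with [S] the squared modulus of the flow. The mean value theorem for [reg_artanh e \o S]
    gives a bound for each [e > 0], and then [e] tends to 0. *)
Lemma artanh_sqrt_lipschitz (S dS : R -> R) c t : 0 < t -> 0 <= c ->
  (forall s, 0 < s < t -> is_derive s 1 S (dS s)) ->
  {within `[0, t], continuous S} ->
  (forall s, 0 <= s <= t -> 0 <= S s < 1) ->
  (forall s, 0 < s < t -> `|dS s| <= 2 * c * (1 - S s) * Num.sqrt (S s)) ->
  `|artanh (Num.sqrt (S t)) - artanh (Num.sqrt (S 0))| <= c * t.
Proof.
move=> t0 c0 SdS cS S01 dSle.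
have key e : 0 < e ->
    `|reg_artanh e (S t) - reg_artanh e (S 0)| <= 2 * Num.sqrt (1 + e) * c * t.
  move=> e0.
  have [||u] := @MVT R (reg_artanh e \o S)
    (fun s => Num.sqrt (1 + e) / (Num.sqrt (S s + e) * (1 - S s)) * dS s)
    0 t t0.
  - move=> s; rewrite in_itv/= => st.
    have /S01/andP[Ss0 Ss1] : 0 <= s <= t by case/andP: st => /ltW-> /ltW->.
    by apply: is_derive1_comp; [exact: is_derive_reg_artanh|exact: SdS].
  - have ch s : 0 <= s <= t -> {for S s, continuous (reg_artanh e)}.
      move=> /S01/andP[Ss0 Ss1].
      apply/differentiable_continuous/derivable1_diffP.
      by have [] := is_derive_reg_artanh e0 Ss0 Ss1.
    move/(continuous_within_itvP _ t0): cS => [cS cS0 cSt].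
    apply/(continuous_within_itvP _ t0); split.
    + move=> s s0t; apply: continuous_comp; first exact: cS.
      by apply: ch; move: s0t; rewrite in_itv/= => /andP[/ltW-> /ltW->].
    + by apply: continuous_cvg cS0; apply: ch; rewrite lexx ltW.
    + by apply: continuous_cvg cSt; apply: ch; rewrite lexx ltW.
  rewrite in_itv/= subr0 => u0t ->.
  have /S01/andP[Su0 Su1] : 0 <= u <= t by case/andP: u0t => /ltW-> /ltW->.
  rewrite normrM (ger0_norm (ltW t0)) ler_wpM2r ?(ltW t0)//.
  have K0 := sqrtr_ge0 (1 + e).
  have r0 : 0 < Num.sqrt (S u + e) by rewrite sqrtr_gt0 ltr_wpDl.
  (* The factor [Num.sqrt (S u)] in the bound on [dS u] is thus absorbed by the denominator, even
     when [S u = 0]. *)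
  have rle : Num.sqrt (S u) <= Num.sqrt (S u + e).
    by rewrite ler_wsqrtr// lerDl ltW.
  have D0 : 0 < Num.sqrt (S u + e) * (1 - S u).
    by rewrite mulr_gt0// subr_gt0.
  rewrite normrM ger0_norm ?divr_ge0 ?(ltW D0)// mulrAC ler_pdivrMr//.
  rewrite [leRHS](_ : _ = Num.sqrt (1 + e) *
    (2 * c * (1 - S u) * Num.sqrt (S u + e))); last by ring.
  apply: ler_wpM2l => //; apply: le_trans (dSle _ u0t) _.
  by rewrite ler_wpM2l// !mulr_ge0// subr_ge0 ltW.
have [S00 S0t] : 0 <= S 0 < 1 /\ 0 <= S t < 1.
  by split; apply: S01; rewrite lexx ltW.
have L : `|reg_artanh e (S t) - reg_artanh e (S 0)| @[e --> 0^'+] -->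
    `|2 * artanh (Num.sqrt (S t)) - 2 * artanh (Num.sqrt (S 0))|.
  by apply: cvg_norm; apply: cvgB; apply: cvg_reg_artanh;
    case/andP: S00 S0t => ? ? /andP[].
have U : 2 * Num.sqrt (1 + e) * c * t @[e --> 0^'+]
    --> 2 * Num.sqrt (1 + 0) * c * t.
  apply: cvg_at_right_filter; do 2 apply: cvgMl; apply: cvgMr.
  apply: (@continuous_comp _ _ _ (fun e : R => 1 + e) Num.sqrt);
    last exact: sqrt_continuous.
  by apply: cvgD; [exact: cvg_cst|exact: cvg_id].
have := ler_cvg_to L U; rewrite addr0 sqrtr1 mulr1 -mulrBr normrM ger0_norm//.
rewrite -!mulrA ler_pM2l//.
by apply; near=> e; apply: key.
Unshelve. all: by end_near. Qed.

(** With [x] occurring once, monotonicity is visible and [expR] meets the [ln] of [artanh]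
    directly. *)
Lemma tanhE x : tanh x = 1 - 2 / (expR (2 * x) + 1).
Proof.
rewrite /tanh expRN [2 * x]mulr_natl mulr2n expRD; have := expR_gt0 x.
move: (expR x) => E E0; have ? : 0 < E * E by rewrite mulr_gt0.
by field; rewrite !lt0r_neq0 ?addr_gt0.
Qed.

Lemma ler_tanh x y : x <= y -> tanh x <= tanh y.
Proof.
move=> xy; rewrite !tanhE lerD2l lerN2 ler_wpM2l//.
rewrite lef_pV2 ?posrE ?addr_gt0 ?expR_gt0//.
by rewrite lerD2r ler_expR ler_wpM2l.
Qed.

Lemma artanhK x : -1 < x < 1 -> tanh (artanh x) = x.
Proof.
case/andP=> x1 x2; rewrite tanhE /artanh [2 * (_ / 2)]mulrC divfK ?pnatr_eq0//.
have p0 : 0 < 1 - x by rewrite subr_gt0.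
rewrite lnK; last by rewrite posrE divr_gt0// -ltrBlDl sub0r.
by field; rewrite gt_eqF//=; lra.
Qed.
End Evolution.

Theorem mainTheorem12 (R : realType) (d : measure_display)
    (Omega : measurableType d) (P : probability Omega R)
    (B : R -> {RV P >-> R}) (hB : brownian_motion B)
    (k : R) (p : R[i] -> R[i])
    (hp : forall z : R[i], normc z < 1 ->
      p z = (1 + z) / (1 - z) * (complex.Re (p 0))%:C + 'i%C * (complex.Im (p 0))%:C)
    (hp0 : 0 <= complex.Re (p 0))
    (phi : R -> R[i] -> Omega -> R[i])
    (hphi : stochastic_evolution (driving_term k B) p phi)
    (omega : Omega) (z : R[i]) (hz : normc z < 1) (t : R) (ht : 0 <= t) :
  tanh (- normc (p 0) * t + artanh (normc z)) <= normc (phi t z omega)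
    <= tanh (normc (p 0) * t + artanh (normc z)).
Proof.
case: hphi => disk start ode.
set c := normc (p 0).
(* Both bounds follow by applying the monotone [tanh], which inverts [artanh] on moduli below 1. *)
suff : `|artanh (normc (phi t z omega)) - artanh (normc z)| <= c * t.
  rewrite ler_norml => /andP[lo up].
  have wK : tanh (artanh (normc (phi t z omega))) = normc (phi t z omega).
    by rewrite artanhK// (lt_le_trans _ (normc_ge0 _)) ?ltrN10 ?disk.
  by rewrite -wK mulNr; apply/andP; split; apply: ler_tanh; lra.
move: ht; rewrite le_eqVlt => /predU1P[<-|t0].
  by rewrite start// subrr normr0 mulr0.
pose w s := phi s z omega.
pose V s := (driving_term k B s omega - w s) ^+ 2 / driving_term k B s omega
  * p (w s / driving_term k B s omega).
pose x s := complex.Re (w s); pose y s := complex.Im (w s).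
pose dx s := complex.Re (V s); pose dy s := complex.Im (V s).
have x_der s : 0 <= s -> real_derivative_ge0 x s (dx s).
  by move=> s0; apply: has_derivative_ge0_Re; exact: ode.
have y_der s : 0 <= s -> real_derivative_ge0 y s (dy s).
  by move=> s0; apply: has_derivative_ge0_Im; exact: ode.
(* Unlike the modulus, its square is differentiable at positive times even where [w] vanishes. *)
pose S s := normc (w s) ^+ 2.
have SE : S = x ^+ 2 + y ^+ 2 by apply/funext => s; rewrite /S normc_sqrE.
have dS (s : R) : 0 < s -> is_derive s 1 S (2 * (x s * dx s + y s * dy s)).
  move=> s0; rewrite SE.
  have ? := real_derivative_ge0_is_derive s0 (x_der s (ltW s0)).
  have ? := real_derivative_ge0_is_derive s0 (y_der s (ltW s0)).
  by apply: is_derive_eq; rewrite !expr1 /GRing.scale /=; ring.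
have S01 (s : R) : 0 <= s <= t -> 0 <= S s < 1.
  case/andP=> s0 _; rewrite /S exprn_ge0 ?normc_ge0//=.
  by rewrite expr_lt1 ?normc_ge0 ?disk.
have nE s : Num.sqrt (S s) = normc (w s).
  by rewrite sqrtr_sqr ger0_norm ?normc_ge0.
have -> : phi t z omega = w t by [].
rewrite -{1}(start omega z hz) -[phi 0 z omega]/(w 0) -!nE.
apply: (artanh_sqrt_lipschitz
  (dS := fun s => 2 * (x s * dx s + y s * dy s))) => //.
- exact: normc_ge0.
- by move=> s /andP[s0 _]; exact: dS.
- have cS (s : R) : 0 < s -> {for s, continuous S}.
    move=> s0; apply/differentiable_continuous/derivable1_diffP.
    by have [] := dS s s0.
  apply/continuous_within_itvP => //; split.
  + by move=> s; rewrite in_itv/= => /andP[s0 _]; exact: cS.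
  + rewrite SE; apply: cvgD; apply: cvgM;
      by [apply: real_derivative_ge0_cvg_right (x_der 0 (lexx _))
         |apply: real_derivative_ge0_cvg_right (y_der 0 (lexx _))].
  + by apply: cvg_at_left_filter; exact: cS.
move=> s /andP[s0 st]; have ws1 : normc (w s) < 1 by rewrite disk// ltW.
have u1 : normc (driving_term k B s omega) = 1 by exact: normc_driving_term.
(* Keeps the argument of [p] in the disk, so that [hp] applies, and turns the Cauchy-Schwarz bound
   into one in [normc (w s)]. *)
have q1 : normc (w s / driving_term k B s omega) = normc (w s).
  by rewrite normcM normcV u1 invr1 mulr1.
have /S01/andP[_ S1] : 0 <= s <= t by rewrite !ltW.
rewrite normrM normr_nat -!mulrA ler_pM2l// /dx /dy /V hp ?q1// dot_velocity//.
rewrite -/(S s) nE normrM ger0_norm ?subr_ge0 ?(ltW S1)// mulrCA.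
apply: ler_wpM2l; first by rewrite subr_ge0 ltW.
by rewrite -q1; exact: ler_norm_dot_normc.
Qed.
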